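(* There is a constant $L < \infty$ independent of $n$ such that $$\sum_{k=1}^\infty \frac{I_k(\widetilde{P}_n)}{k} < L\,, \qquad n=0,1,2,\ldots.$$
   Context: The Rudin-Shapiro polynomials are defined recursively by $P_0(z) := 1$, $Q_0(z) := 1$, and $$P_{n+1}(z) := P_n(z) + z^{2^n}Q_n(z)\,, \qquad Q_{n+1}(z) := P_n(z) - z^{2^n}Q_n(z)\,, \qquad n=0,1,2,\ldots.$$ The normalized polynomial is $\widetilde{P}_n := 2^{-(n+1)/2}P_n$. For $q>0$, $$I_q(\widetilde{P}_n) := \frac{1}{2\pi}\int_0^{2\pi} |\widetilde{P}_n(e^{i\tau})|^q\,d\tau\,.$$ *)

(* Defs.v *)
From HB Require Import structures.
From mathcomp Require Import all_boot all_order all_algebra.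
From mathcomp Require Import complex.
From mathcomp Require Import all_classical all_reals all_analysis.

Set Implicit Arguments.
Unset Strict Implicit.
Unset Printing Implicit Defensive.

Import Order.TTheory GRing.Theory Num.Theory.

Local Open Scope classical_set_scope.
Local Open Scope ring_scope.

Fixpoint rudin_shapiro_pair (R : realType) (n : nat) :
    {poly R[i]} * {poly R[i]} :=
  if n is m.+1 then
    let: (P, Q) := rudin_shapiro_pair R m in
    (P + 'X^(2 ^ m) * Q, P - 'X^(2 ^ m) * Q)
  else (1, 1).

Definition rudin_shapiro_P (R : realType) (n : nat) : {poly R[i]} :=
  (rudin_shapiro_pair R n).1.

Definition rudin_shapiro_Q (R : realType) (n : nat) : {poly R[i]} :=
  (rudin_shapiro_pair R n).2.

Definition normalized_P (R : realType) (n : nat) : {poly R[i]} :=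
  (2 `^ (- (n.+1%:R / 2)))%:C%C *: rudin_shapiro_P R n.

Definition expi (R : realType) (t : R) : R[i] := (cos t +i* sin t)%C.

(* Extended-real valued, so that no default value is hidden in the integral;
   [normc] is the modulus with values in [R], and [`^] is the real power. *)
Definition Iq (R : realType) (q : R) (p : {poly R[i]}) : \bar R :=
  (((2 * pi)^-1)%:E *
   \int[lebesgue_measure]_(t in `[0%R, (2 * pi)%R])
      ((ComplexField.Normc.normc p.[expi t] `^ q)%:E))%E.

(* Main.v *)
Require Import Defs.
From mathcomp Require Import all_boot all_order all_algebra.
From mathcomp Require Import complex.
From mathcomp Require Import all_classical all_reals all_analysis.
From mathcomp Require Import measurable_realfun.
From mathcomp Require Import ring lra.

(** On the unit circle the normalized pair satisfies |P|^2 + |Q|^2 = 1, so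
with x = |P| and y = |Q| the sum of the x^k / k is -ln (1 - x), which is at
most a constant plus 2 ln (1/y).  The theorem therefore amounts to an upper
bound, uniform in n, for the mean of ln (1/|Q|) over the circle, i.e. to a
positive lower bound for the Mahler measures of the normalized Q.

The singularities of the logarithm are avoided throughout by working with
roots of unity.  Partial sums up to exponent K are bounded by
2 ln (4 / (y^2 + 2/(K+1))) ([log_partial_le]), and the integral of such a
partial sum is controlled by its Riemann sums at m-th roots of unity, m large
([integral_riemann_le]).  The product of |q(zeta)|^2 + e over the m-th roots of
unity zeta is, for m large, at least the (2m)-th power of half the Mahler
measure of q ([regularized_prod_ge]).

The lower bound for the Mahler measure is of large sieve type.  With
N = 2^n and n >= 2, among any two adjacent N-th roots of unity at least one
makes |Q| larger than a fixed constant ([adjacent_roots]): at such a point Q_n reduces to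
2 P_(n-2) or 2 Q_(n-2) up to a unit, alternately, and the point of the sphere
that records the pair (P_(n-2), Q_(n-2)) up to phase moves too slowly for one
of these to be small and then the other.  A polynomial of degree at most N that
is bounded below on one of any two adjacent N-th roots of unity has its Mahler
measure bounded below ([mahler_ge]): replace each root of unity where it is
small by its two neighbours, and compare, for each zero w separately, the
resulting product of distances to w with the full product, |w^N - 1|.

Both comparisons for a single zero w rest on one identity
([smoothed_factor]): for |z| = 1, |z - w|^2 + t equals |a z - b u|^2 with
0 <= b <= a and |u| = 1, so its product over the N-th roots of unity is
|a^N - b^N u^N|^2, while a is max(1, |w|) up to sqrt t. *)

Set Implicit Arguments.
Unset Strict Implicit.
Unset Printing Implicit Defensive.

Import Order.TTheory GRing.Theory Num.Theory.
Import numFieldNormedType.Exports.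
Import ComplexField.Normc.

Local Open Scope classical_set_scope.
Local Open Scope ring_scope.

(** * The modulus of complex numbers *)

Section ComplexModulus.
Variable R : rcfType.
Implicit Types (z w u : R[i]) (x y t : R).

Lemma normc_ge0 z : 0 <= normc z.
Proof. by case: z => x y; exact: sqrtr_ge0. Qed.

Lemma normc_sqrE z : normc z ^+ 2 = complex.Re z ^+ 2 + complex.Im z ^+ 2.
Proof. by case: z => x y; rewrite /= sqr_sqrtr// addr_ge0 ?sqr_ge0. Qed.

Lemma normcR x : normc x%:C%C = `|x|.
Proof. by rewrite /= expr0n addr0 sqrtr_sqr. Qed.

Lemma normcX z n : normc (z ^+ n) = normc z ^+ n.
Proof.
elim: n => [|n IH]; first by rewrite !expr0 normc1.
by rewrite !exprS normcM IH.
Qed.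

Lemma normc_prod (I : Type) (r : seq I) (F : I -> R[i]) :
  normc (\prod_(i <- r) F i) = \prod_(i <- r) normc (F i).
Proof.
exact: (big_morph _ (@normcM R) (normc1 R)).
Qed.

Lemma ler_normcD z w : normc (z + w) <= normc z + normc w.
Proof. exact: le_normcD. Qed.

Lemma normc_sum (I : Type) (r : seq I) (F : I -> R[i]) :
  normc (\sum_(i <- r) F i) <= \sum_(i <- r) normc (F i).
Proof.
elim: r => [|i r IH]; first by rewrite !big_nil normc0.
by rewrite !big_cons; apply: le_trans (ler_normcD _ _) _; rewrite lerD2l.
Qed.

Lemma normc_opp z : normc (- z) = normc z.
Proof. exact: normcN. Qed.

Lemma normc_distC z w : normc (z - w) = normc (w - z).
Proof. by rewrite -normc_opp opprB. Qed.

Lemma ler_normcB z w : normc z - normc w <= normc (z - w).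
Proof. by rewrite lerBlDr -{1}(subrK w z); exact: ler_normcD. Qed.

(** With r = |w|, the left side is A - 2 r cos x, where A = 1 + r^2 + t and x
is the angle between z and w.  The right side has this form exactly when
a^2 + b^2 = A and a b = r, i.e. a + b and a - b are the square roots of
(1 + r)^2 + t and (1 - r)^2 + t.  When t = 0 this gives a = max(1, r). *)
Lemma smoothed_factor w t : 0 <= t ->
  exists a b u,
    [/\ 0 <= b <= a, Num.max 1 (normc w) <= a <= Num.max 1 (normc w) + Num.sqrt t,
        0 < t -> b < a, normc u = 1 &
        forall z, normc z = 1 ->
          normc (z - w) ^+ 2 + t = normc (a%:C%C * z - b%:C%C * u) ^+ 2].
Proof.
move=> t0; set r := normc w.
have r0 : 0 <= r by exact: normc_ge0.
pose sp := Num.sqrt ((1 + r) ^+ 2 + t); pose sm := Num.sqrt ((1 - r) ^+ 2 + t).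
have sp2 : sp ^+ 2 = (1 + r) ^+ 2 + t by rewrite sqr_sqrtr// addr_ge0 ?sqr_ge0.
have sm2 : sm ^+ 2 = (1 - r) ^+ 2 + t by rewrite sqr_sqrtr// addr_ge0 ?sqr_ge0.
have sp0 : 0 <= sp by exact: sqrtr_ge0.
have sm0 : 0 <= sm by exact: sqrtr_ge0.
have st0 : 0 <= Num.sqrt t by exact: sqrtr_ge0.
have st2 : Num.sqrt t ^+ 2 = t by rewrite sqr_sqrtr.
have smp : sm <= sp by rewrite ler_wsqrtr//; nra.
have lsp : 1 + r <= sp.
  by rewrite -(@ler_pXn2r _ 2) ?nnegrE ?sp2 ?addr_ge0// lerDl.
have usp : sp <= 1 + r + Num.sqrt t.
  rewrite -(@ler_pXn2r _ 2) ?nnegrE ?addr_ge0// sp2 -{1}st2; nra.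
have lsm : `|1 - r| <= sm.
  by rewrite -(@ler_pXn2r _ 2) ?nnegrE// sm2 real_normK ?num_real// lerDl.
have usm : sm <= `|1 - r| + Num.sqrt t.
  rewrite -(@ler_pXn2r _ 2) ?nnegrE ?addr_ge0// sm2 -{1}st2.
  have := real_normK (num_real (1 - r)); have := normr_ge0 (1 - r); nra.
have [u u1 wu] : exists2 u, normc u = 1 & w = r%:C%C * u.
  have [r_eq0|rN0] := eqVneq r 0.
    exists 1; first exact: normc1.
    by rewrite r_eq0 mul0r; exact: eq0_normc.
  have rCN0 : r%:C%C != 0 :> R[i] by rewrite -(inj_eq (@complexI R)) in rN0.
  exists (w / r%:C%C); last by rewrite mulrC divfK.
  rewrite normcM normcV normcR ger0_norm//.
  by rewrite divff.
exists ((sp + sm) / 2), ((sp - sm) / 2), u; split=> //.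
- by apply/andP; split; lra.
- case: (ger0P (1 - r)) lsm usm => ? ? ?; case: (lerP 1 r) => ?;
  by apply/andP; split; lra.
- move=> tp; suff : 0 < sm by lra.
  by rewrite sqrtr_gt0; have := sqr_ge0 (1 - r); lra.
- move=> z z1.
  have := normc_sqrE z; have := normc_sqrE u; rewrite z1 u1 wu expr1n !normc_sqrE.
  case: z {z1} => x y; case: u {u1 wu} => p q /= hu hz.
  move: sp2 sm2; rewrite -/sp -/sm; clearbody sp sm.
  move=> sp2 sm2.
  have ab : (sp + sm) / 2 * ((sp - sm) / 2) = r.
    have -> : r = ((1 + r) ^+ 2 + t - ((1 - r) ^+ 2 + t)) / 4 by field.
    by rewrite -sp2 -sm2; field.
  have a2b2 : ((sp + sm) / 2) ^+ 2 + ((sp - sm) / 2) ^+ 2 = 1 + r ^+ 2 + t.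
    have -> : 1 + r ^+ 2 + t = ((1 + r) ^+ 2 + t + ((1 - r) ^+ 2 + t)) / 2 by field.
    by rewrite -sp2 -sm2; field.
  set a := (sp + sm) / 2 in ab a2b2 *; set b := (sp - sm) / 2 in ab a2b2 *.
  have -> : (x - (r * p - 0 * q)) ^+ 2 + (y - (r * q + 0 * p)) ^+ 2 + t
    = (x ^+ 2 + y ^+ 2) + r ^+ 2 * (p ^+ 2 + q ^+ 2) - 2 * r * (x * p + y * q) + t by ring.
  have -> : (a * x - 0 * y - (b * p - 0 * q)) ^+ 2
          + (a * y + 0 * x - (b * q + 0 * p)) ^+ 2
    = a ^+ 2 * (x ^+ 2 + y ^+ 2) + b ^+ 2 * (p ^+ 2 + q ^+ 2)
      - 2 * (a * b) * (x * p + y * q) by ring.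
  rewrite -hz -hu ab !mulr1 a2b2; ring.
Qed.

End ComplexModulus.

(** * Products over roots of unity *)

Section RootsOfUnity.
Variable R : realType.
Implicit Types (z w u om : R[i]) (x y t : R).

Lemma prod_prim_root (F : fieldType) (n : nat) (om x y : F) :
  n.-primitive_root om -> \prod_(0 <= k < n) (x - om ^+ k * y) = x ^+ n - y ^+ n.
Proof.
move=> prim_om; have n0 := prim_order_gt0 prim_om.
have [->|yN0] := eqVneq y 0.
  rewrite (eq_bigr (fun=> x)) => [|k _]; last by rewrite mulr0 subr0.
  by rewrite prodr_const_nat subn0 expr0n gtn_eqF// subr0.
have /(congr1 (fun p => p.[x / y])) := factor_Xn_sub_1 prim_om.
rewrite horner_prod !hornerE => h.
rewrite (eq_bigr (fun k => ('X - (om ^+ k)%:P).[x / y] * y)) => [|k _]; last first.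
  by rewrite !hornerE mulrBl divfK.
rewrite big_split/= h prodr_const_nat subn0 mulrBl mul1r.
by rewrite exprMn exprVn divfK// expf_neq0.
Qed.

Lemma normc_unity_root n z : (0 < n)%N -> z ^+ n = 1 -> normc z = 1.
Proof.
move=> n0 zn1; apply/eqP; rewrite -(@pexpr_eq1 _ _ n) ?normc_ge0//.
by rewrite -normcX zn1 normc1.
Qed.

Lemma normc_prim_root n om : n.-primitive_root om -> normc om = 1.
Proof.
by move=> h; exact: normc_unity_root (prim_order_gt0 h) (prim_expr_order h).
Qed.

(** The product of the a z - b u over the n-th roots of unity z is
a^n - b^n u^n up to sign, whose modulus is known up to the direction of u^n. *)
Lemma smoothed_prod n om w t a b u : n.-primitive_root om ->
  0 <= b <= a -> normc u = 1 ->
  (forall z, normc z = 1 ->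
     normc (z - w) ^+ 2 + t = normc (a%:C%C * z - b%:C%C * u) ^+ 2) ->
  (a ^+ n - b ^+ n) ^+ 2 <= \prod_(0 <= k < n) (normc (om ^+ k - w) ^+ 2 + t)
    <= (a ^+ n + b ^+ n) ^+ 2.
Proof.
move=> prim_om /andP[b0 ba] u1 H.
have a0 : 0 <= a by exact: le_trans ba.
have -> : \prod_(0 <= k < n) (normc (om ^+ k - w) ^+ 2 + t)
    = normc ((b%:C%C * u) ^+ n - a%:C%C ^+ n) ^+ 2.
  rewrite -(prod_prim_root _ _ prim_om) normc_prod -prodrXl.
  apply: eq_bigr => k _; rewrite H; last first.
    by rewrite normcX (normc_prim_root prim_om) expr1n.
  by rewrite normc_distC [in X in _ - X]mulrC.
have nb : normc ((b%:C%C * u) ^+ n) = b ^+ n.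
  by rewrite normcX normcM u1 mulr1 normcR ger0_norm.
have na : normc (a%:C%C ^+ n) = a ^+ n by rewrite normcX normcR ger0_norm.
have ban : b ^+ n <= a ^+ n by rewrite lerXn2r.
rewrite !ler_sqr ?nnegrE ?subr_ge0 ?normc_ge0 ?addr_ge0 ?exprn_ge0//.
apply/andP; split.
  by rewrite normc_distC -na -nb ler_normcB.
by rewrite addrC -na -nb -(normc_opp (a%:C%C ^+ n)) ler_normcD.
Qed.

Lemma smoothed_prod_le n om w t : 0 <= t -> n.-primitive_root om ->
  \prod_(0 <= k < n) (normc (om ^+ k - w) ^+ 2 + t) <=
    4 * (Num.max 1 (normc w) + Num.sqrt t) ^+ (2 * n).
Proof.
move=> t0 prim_om.
have [a [b [u [ba /andP[a1 a2] _ u1 H]]]] := smoothed_factor w t0.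
have /andP[_ h] := smoothed_prod prim_om ba u1 H.
case/andP: ba => b0 ba; have a0 : 0 <= a by exact: le_trans ba.
apply: le_trans h _; rewrite mulnC exprM.
have -> : 4 = 2 ^+ 2 :> R by ring.
rewrite -exprMn ler_sqr ?nnegrE ?addr_ge0 ?mulr_ge0 ?exprn_ge0//; last first.
  exact: le_trans a2.
have : b ^+ n <= a ^+ n by rewrite lerXn2r.
have : a ^+ n <= (Num.max 1 (normc w) + Num.sqrt t) ^+ n.
  by rewrite lerXn2r// nnegrE (le_trans a0).
lra.
Qed.

Lemma smoothed_prod_ge w t : 0 < t -> exists n0, forall n om,
  (n0 <= n)%N -> n.-primitive_root om ->
  Num.max 1 (normc w) ^+ (2 * n) / 4 <=
    \prod_(0 <= k < n) (normc (om ^+ k - w) ^+ 2 + t).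
Proof.
move=> t0.
have [a [b [u [ba /andP[a1 _] blta u1 H]]]] := smoothed_factor w (ltW t0).
have a0 : 0 < a by apply: lt_le_trans a1; rewrite lt_max ltr01.
have b0 : 0 <= b by case/andP: ba.
have q0 : 0 <= b / a by rewrite divr_ge0// ltW.
have q1 : b / a < 1 by rewrite ltr_pdivrMr// mul1r blta.
have : (fun n => (b / a) ^+ n) @ \oo --> (0 : R).
  by apply: cvg_expr; rewrite ger0_norm.
move=> /cvgr_lt /(_ 2^-1) []; first by rewrite invr_gt0.
move=> n0 _ hn0; exists n0 => n om n0n prim_om.
have /andP[h _] := smoothed_prod prim_om ba u1 H.
apply: le_trans h.
have /ltW := hn0 n n0n; rewrite /= expr_div_n ler_pdivrMr ?exprn_gt0// => hb.
have -> : 4^-1 = 2^-1 ^+ 2 :> R by field.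
rewrite mulnC exprM -exprMn ler_sqr ?nnegrE; last first.
- by have : 0 <= a ^+ n by [rewrite exprn_ge0// ltW]; lra.
- by rewrite mulr_ge0// exprn_ge0// le_max ler01.
have : Num.max 1 (normc w) ^+ n <= a ^+ n.
  by rewrite lerXn2r// ?nnegrE ?(ltW a0)// le_max ler01.
lra.
Qed.

(** The product (z/om - w)(z om - w) differs from (z - w)^2 only by
z w (1 - om)(1 - 1/om): moving a node to its two neighbours is harmless away
from w, and the extra term keeps the estimate valid near w as well. *)
Lemma neighbours_le om z w : normc om = 1 -> normc z = 1 ->
  normc (z / om - w) * normc (z * om - w) <=
    normc (z - w) ^+ 2 + normc (1 - om) ^+ 2 * normc w.
Proof.
move=> om1 z1; rewrite -normcM.
have omN0 : om != 0.
  by apply/eqP => om0; move: om1; rewrite om0 normc0; lra.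
have -> : (z / om - w) * (z * om - w)
    = (z - w) ^+ 2 + z * w * ((1 - om) * (1 - om^-1)) by field.
apply: le_trans (ler_normcD _ _) _.
rewrite normcX !normcM z1 mul1r.
have -> : 1 - om^-1 = - (1 - om) / om by field.
rewrite normcM normc_opp normcV om1.
by rewrite invr1 mulr1 [leRHS]addrC [leLHS]addrC lerD2r mulrC expr2.
Qed.

(** The nodes with [g k = false] are replaced by their two neighbours.  Every
factor then becomes at most a smoothed factor with t = |1 - om|^2 |w|; as
n |1 - om| is bounded for the nodes used later, the (2n)-th power loses only a
constant. *)
Lemma gap_prod_le n om (g : nat -> bool) w : n.-primitive_root om ->
  \prod_(0 <= k < n)
     (if g k then normc (om ^+ k - w) ^+ 2
      else normc (om ^+ k / om - w) * normc (om ^+ k * om - w)) <=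
    4 * (Num.max 1 (normc w) * (1 + normc (1 - om))) ^+ (2 * n).
Proof.
move=> prim_om; have om1 := normc_prim_root prim_om.
set d := normc (1 - om); have d0 : 0 <= d by exact: normc_ge0.
have w0 : 0 <= normc w by exact: normc_ge0.
have t0 : 0 <= d ^+ 2 * normc w by rewrite mulr_ge0// sqr_ge0.
apply: le_trans (_ : _ <= \prod_(0 <= k < n)
    (normc (om ^+ k - w) ^+ 2 + d ^+ 2 * normc w)) _.
  apply: ler_prod => k _; case: (g k).
    by rewrite sqr_ge0 lerDl.
  rewrite mulr_ge0 ?normc_ge0// neighbours_le//.
  by rewrite normcX om1 expr1n.
apply: le_trans (smoothed_prod_le w t0 prim_om) _.
rewrite ler_wpM2l// lerXn2r// ?nnegrE ?addr_ge0 ?mulr_ge0 ?addr_ge0 ?le_max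
  ?ler01 ?sqrtr_ge0//.
rewrite mulrDr mulr1 lerD2l sqrtrM ?sqr_ge0// sqrtr_sqr ger0_norm// mulrC.
rewrite ler_wpM2r//.
rewrite -(@ler_pXn2r _ 2) ?nnegrE ?sqrtr_ge0 ?le_max ?ler01// sqr_sqrtr//.
by case: (lerP 1 (normc w)); nra.
Qed.

End RootsOfUnity.

(** * Mahler measure *)

Section MahlerMeasure.
Variable R : realType.
Implicit Types (p q : {poly R[i]}) (z w om : R[i]) (ws : seq R[i]) (t : R).

Lemma prodr_const_seq (A : Type) (r : seq A) (x : R) :
  \prod_(i <- r) x = x ^+ size r.
Proof. by rewrite big_const_seq count_predT iter_mulr_1. Qed.

(** The Mahler measure, by Jensen's formula. *)
Definition mahler p : R :=
  normc (lead_coef p) *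
    \prod_(w <- sval (closed_field_poly_normal p)) Num.max 1 (normc w).

Lemma max1_gt0 (x : R) : 0 < Num.max 1 x.
Proof. by rewrite lt_max ltr01. Qed.

Lemma normc_lead_coef_gt0 p : p != 0 -> 0 < normc (lead_coef p).
Proof.
move=> pN0; rewrite lt_neqAle normc_ge0 andbT eq_sym.
apply: contra pN0 => /eqP h.
by rewrite -lead_coef_eq0; apply/eqP; exact: eq0_normc.
Qed.

Lemma mahler_gt0 p : p != 0 -> 0 < mahler p.
Proof.
move=> pN0; rewrite /mahler mulr_gt0//; last first.
  by rewrite big_seq; apply: prodr_gt0 => w _; exact: max1_gt0.
exact: normc_lead_coef_gt0.
Qed.

Lemma normc_horner_roots p z :
  normc p.[z] = normc (lead_coef p) *
    \prod_(w <- sval (closed_field_poly_normal p)) normc (z - w).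
Proof.
case: closed_field_poly_normal => ws /= e.
rewrite {1}e hornerZ horner_prod normcM normc_prod.
by congr (_ * _); apply: eq_bigr => w _; rewrite !hornerE.
Qed.

Lemma size_poly_roots p : p != 0 ->
  size p = (size (sval (closed_field_poly_normal p))).+1.
Proof.
case: closed_field_poly_normal => ws /= e pN0.
by rewrite {1}e size_scale ?size_prod_XsubC// lead_coef_eq0.
Qed.

(** One inequality of [gap_prod_le] is spent for each of the at most n zeros;
the accumulated factor 4^n becomes the harmless 2 after taking (2n)-th roots. *)
Lemma mahler_ge n om p (g : nat -> bool) (c : R) : n.-primitive_root om ->
  p != 0 -> (size p <= n.+1)%N -> 0 <= c ->
  (forall k, (k < n)%N ->
     if g k then c <= normc p.[om ^+ k]
     else (c <= normc p.[om ^+ k / om]) && (c <= normc p.[om ^+ k * om])) ->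
  c <= mahler p * (2 * (1 + normc (1 - om)) ^+ n).
Proof.
move=> prim_om pN0 sp c0 H; have n0 := prim_order_gt0 prim_om.
set d := normc (1 - om); have d0 : 0 <= d by exact: normc_ge0.
pose F k z := if g k then normc (om ^+ k - z) ^+ 2
              else normc (om ^+ k / om - z) * normc (om ^+ k * om - z).
have m0 := mahler_gt0 pN0.
have D0 : 0 <= (1 + d) ^+ n by rewrite exprn_ge0// addr_ge0.
rewrite -(@ler_pXn2r _ (2 * n)) ?muln_gt0// ?nnegrE//; last first.
  by rewrite mulr_ge0 ?(ltW m0)// mulr_ge0.
set ws := sval (closed_field_poly_normal p).
have FE k : (if g k then normc p.[om ^+ k] ^+ 2
     else normc p.[om ^+ k / om] * normc p.[om ^+ k * om])
   = normc (lead_coef p) ^+ 2 * \prod_(w <- ws) F k w.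
  rewrite /F; case: (g k); rewrite !normc_horner_roots -/ws.
    by rewrite exprMn prodrXl.
  by rewrite big_split/=; ring.
apply: le_trans (_ : _ <= \prod_(0 <= k < n)
    (if g k then normc p.[om ^+ k] ^+ 2
     else normc p.[om ^+ k / om] * normc p.[om ^+ k * om])) _.
  have -> : c ^+ (2 * n) = \prod_(0 <= k < n) c ^+ 2.
    by rewrite prodr_const_nat subn0 exprM.
  rewrite big_seq [leRHS]big_seq.
  apply: ler_prod => k; rewrite mem_index_iota/= => kn.
  rewrite exprn_ge0//=; have := H k kn; case: (g k).
    by move=> h; rewrite ler_sqr ?nnegrE ?normc_ge0.
  by move=> /andP[h1 h2]; rewrite expr2 ler_pM.
under eq_bigr do rewrite FE.
rewrite big_split/= prodr_const_nat subn0 exchange_big/= -exprM.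
rewrite [leRHS]exprMn /mahler -/ws exprMn -mulrA.
rewrite ler_wpM2l ?exprn_ge0 ?normc_ge0//.
apply: le_trans (_ : _ <= \prod_(w <- ws)
    (Num.max 1 (normc w) ^+ (2 * n) * (4 * (1 + d) ^+ (2 * n)))) _.
  apply: ler_prod => w _; apply/andP; split.
    apply: prodr_ge0 => k _; rewrite /F; case: (g k) => //.
      by rewrite sqr_ge0.
    by rewrite mulr_ge0 ?normc_ge0.
  apply: le_trans (gap_prod_le g w prim_om) _.
  by rewrite -/d exprMn mulrCA.
rewrite big_split/= prodrXl ler_wpM2l//.
  by rewrite exprn_ge0// prodr_ge0// => w _; exact/ltW/max1_gt0.
rewrite prodr_const_seq.
have sws : (size ws <= n)%N by rewrite -ltnS -size_poly_roots.
apply: le_trans (_ : _ <= (4 * (1 + d) ^+ (2 * n)) ^+ n) _.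
  apply: ler_weXn2l => //.
  have : 1 <= (1 + d) ^+ (2 * n) by rewrite exprn_ege1// lerDl.
  lra.
have -> : 4 * (1 + d) ^+ (2 * n) = (2 * (1 + d) ^+ n) ^+ 2.
  by rewrite exprMn mulnC exprM; congr (_ * _); ring.
by rewrite -exprM.
Qed.

(** Smoothing all the factors at once is a small perturbation, uniformly on
the circle; the slope in t is crude but explicit. *)
Lemma smoothed_horner_le ws z t : normc z = 1 -> 0 <= t <= 1 ->
  \prod_(w <- ws) (normc (z - w) ^+ 2 + t) <=
    \prod_(w <- ws) normc (z - w) ^+ 2 +
    t * \prod_(w <- ws) ((1 + normc w) ^+ 2 + 1).
Proof.
move=> z1 /andP[t0 t1]; elim: ws => [|w ws IH].
  by rewrite !big_nil mulr1 lerDl.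
rewrite !big_cons.
set A := \prod_(j <- ws) (_ + t) in IH *; set B := \prod_(j <- ws) _ in IH *.
set D := \prod_(j <- ws) _ in IH *.
have hz : normc (z - w) <= 1 + normc w.
  by rewrite -z1 -(normc_opp w) ler_normcD.
have AD : A <= D.
  apply: ler_prod => v _; rewrite addr_ge0 ?sqr_ge0//= lerD//.
  rewrite ler_sqr ?nnegrE ?addr_ge0 ?normc_ge0//.
  by rewrite -z1 -(normc_opp v) ler_normcD.
have x0 : 0 <= normc (z - w) ^+ 2 by rewrite sqr_ge0.
have xB : normc (z - w) ^+ 2 <= (1 + normc w) ^+ 2.
  by rewrite ler_sqr ?nnegrE ?addr_ge0 ?normc_ge0.
have D0 : 0 <= D by apply: prodr_ge0 => v _; rewrite addr_ge0// sqr_ge0.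
have tD : 0 <= t * D by rewrite mulr_ge0.
move: (normc (z - w) ^+ 2) ((1 + normc w) ^+ 2) x0 xB => x E x0 xE.
rewrite mulrDl.
have h1 : x * A <= x * B + x * (t * D) by rewrite -mulrDr ler_wpM2l.
have h2 : t * A <= t * D by rewrite ler_wpM2l.
have h3 : x * (t * D) <= E * (t * D) by rewrite ler_wpM2r.
lra.
Qed.

(** The regularization e is traded for a small t in each factor |z - w|^2 + t,
after which [smoothed_prod_ge] applies zero by zero.  This also covers zeros
on the circle, where the unregularized product may vanish.  The factors 1/4, one
per zero, are absorbed in 2^-(2n) as soon as n exceeds the degree. *)
Lemma regularized_prod_ge p (e : R) : p != 0 -> 0 < e ->
  exists n0, forall n om, (n0 <= n)%N -> n.-primitive_root om ->
    (mahler p / 2) ^+ (2 * n) <=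
      \prod_(0 <= k < n) (normc p.[om ^+ k] ^+ 2 + e).
Proof.
move=> pN0 e0.
set ws := sval (closed_field_poly_normal p).
set c := normc (lead_coef p).
have c0 : 0 < c by exact: normc_lead_coef_gt0.
pose D := \prod_(w <- ws) ((1 + normc w) ^+ 2 + 1).
have D0 : 0 < D.
  by rewrite /D big_seq; apply: prodr_gt0 => v _; rewrite ltr_wpDl// sqr_ge0.
pose t := Num.min 1 (e / (c ^+ 2 * D)).
have t0 : 0 < t by rewrite lt_min ltr01/= divr_gt0// mulr_gt0// exprn_gt0.
have t1 : t <= 1 by rewrite ge_min lexx.
have tD : c ^+ 2 * (t * D) <= e.
  rewrite mulrCA -ler_pdivlMr ?mulr_gt0 ?exprn_gt0//.
  by rewrite ge_min lexx orbT.
have [n1 hn1] : exists n1, forall n om, (n1 <= n)%N -> n.-primitive_root om ->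
    \prod_(w <- ws) (Num.max 1 (normc w) ^+ (2 * n) / 4) <=
    \prod_(w <- ws) \prod_(0 <= k < n) (normc (om ^+ k - w) ^+ 2 + t).
  elim: (ws) => [|w s [n1 IH]].
    by exists 0%N => n om _ _; rewrite !big_nil.
  have [n2 hn2] := smoothed_prod_ge w t0.
  exists (maxn n1 n2) => n om; rewrite geq_max => /andP[h1 h2] prim_om.
  rewrite !big_cons ler_pM ?hn2 ?IH//.
    by rewrite divr_ge0// exprn_ge0// ltW// max1_gt0.
  by apply: prodr_ge0 => v _; rewrite divr_ge0// exprn_ge0// ltW// max1_gt0.
exists (maxn n1 (size ws)) => n om; rewrite geq_max => /andP[nn1 nws] prim_om.
apply: le_trans (_ : \prod_(0 <= k < n) (c ^+ 2 *
    \prod_(w <- ws) (normc (om ^+ k - w) ^+ 2 + t)) <= _); last first.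
  apply: ler_prod => k _; apply/andP; split.
    rewrite mulr_ge0 ?sqr_ge0// prodr_ge0// => w _.
    by rewrite addr_ge0 ?sqr_ge0// ltW.
  have z1 : normc (om ^+ k) = 1 by rewrite normcX (normc_prim_root prim_om) expr1n.
  rewrite normc_horner_roots -/ws -/c exprMn -prodrXl.
  apply: le_trans (_ : c ^+ 2 * (\prod_(w <- ws) normc (om ^+ k - w) ^+ 2 + t * D) <= _).
    by rewrite ler_wpM2l ?sqr_ge0// smoothed_horner_le// (ltW t0).
  by rewrite mulrDr lerD2l.
rewrite big_split/= prodr_const_nat subn0 exchange_big/= -exprM.
apply: le_trans (_ : _ <= c ^+ (2 * n) *
   \prod_(w <- ws) (Num.max 1 (normc w) ^+ (2 * n) / 4)) _; last first.
  by rewrite ler_wpM2l ?hn1// exprn_ge0// ltW.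
rewrite big_split/= prodrXl prodr_const_seq.
rewrite /mahler -/ws -/c !exprMn mulrA ler_wpM2l//.
  rewrite mulr_ge0 ?exprn_ge0 ?(ltW c0)// prodr_ge0// => w _.
  exact/ltW/max1_gt0.
have -> : 2^-1 ^+ (2 * n) = 4^-1 ^+ n :> R by rewrite exprM; congr (_ ^+ _); field.
by rewrite ler_wiXn2l// ?invr_ge0// invf_le1// ler1n.
Qed.

End MahlerMeasure.

(** * The exponential on the unit circle *)

Section UnitCircle.
Variable R : realType.
Implicit Types (s t : R) (n : nat).

Lemma expiD s t : expi (s + t) = expi s * expi t.
Proof.
apply/eqP; rewrite eq_complex /= cosD sinD eqxx /=.
by apply/eqP; ring.
Qed.

Lemma expi0 : expi 0 = 1 :> R[i].
Proof. by rewrite /expi cos0 sin0. Qed.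

Lemma expiMn t n : expi (t *+ n) = expi t ^+ n.
Proof.
elim: n => [|n IH]; first by rewrite mulr0n expi0 expr0.
by rewrite mulrS expiD exprS IH.
Qed.

Lemma normc_expi t : normc (expi t) = 1.
Proof. by rewrite /= cos2Dsin2 sqrtr1. Qed.

Lemma sin_le_id t : 0 <= t -> sin t <= t.
Proof.
rewrite le_eqVlt => /predU1P[<-|t0]; first by rewrite sin0.
have [|x _] := @MVT R sin cos 0 t t0 (fun x _ => is_derive_sin x).
  by apply/continuous_subspaceT => ?; exact: continuous_sin.
by rewrite sin0 !subr0 => ->; rewrite ler_piMl ?cos_le1// ltW.
Qed.

Lemma normc_1Bexpi t : normc (1 - expi t) <= `|t|.
Proof.
have [x ->] : exists x, t = x *+ 2 by exists (t / 2); rewrite mulr2n -splitr.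
rewrite -[leLHS]ger0_norm ?normc_ge0// -ler_sqr ?nnegrE// real_normK ?num_real//.
rewrite normc_sqrE /= cos_mulr2n sin_mulr2n real_normK ?num_real//.
have sx : sin x ^+ 2 <= x ^+ 2.
  rewrite -[leLHS]real_normK ?num_real// -[leRHS]real_normK ?num_real//.
  rewrite ler_sqr ?nnegrE//.
  wlog x0 : x / 0 <= x => [H|].
    have [/H//|/ltW x0] := leP 0 x.
    by have := H (- x); rewrite sinN !normrN; apply; rewrite oppr_ge0.
  rewrite (ger0_norm x0) ler_norml sin_le_id// andbT.
  have [h|h] := leP x pi.
    have : 0 <= sin x by rewrite sin_ge0_pi// x0.
    lra.
  by have := sin_geN1 x; have := @pi_ge2 R; lra.
have := cos2Dsin2 x; move: sx; move: (cos x) (sin x) => c s sx h.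
have c2 : c ^+ 2 = 1 - s ^+ 2 by rewrite -h addrK.
have -> : (1 - (c ^+ 2 *+ 2 - 1)) ^+ 2 + (0 - c * s *+ 2) ^+ 2
  = 4 * (1 - c ^+ 2) ^+ 2 + 4 * c ^+ 2 * s ^+ 2 by ring.
have -> : (x *+ 2) ^+ 2 = 4 * x ^+ 2 by ring.
have -> : 4 * (1 - c ^+ 2) ^+ 2 + 4 * c ^+ 2 * s ^+ 2 = 4 * s ^+ 2.
  by rewrite c2; ring.
by rewrite ler_wpM2l.
Qed.

Lemma prim_root_expi n : (0 < n)%N ->
  n.-primitive_root (expi (2 * pi / n%:R : R)).
Proof.
move=> n0; have nR0 : 0 < n%:R :> R by rewrite ltr0n.
apply/andP; split=> //; apply/forallP => i; apply/eqP.
have en k : expi (2 * pi / n%:R : R) ^+ k = expi (k%:R / n%:R * pi *+ 2).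
  rewrite -expiMn; congr expi; rewrite -[LHS]mulr_natr -[RHS]mulr_natr.
  by field; rewrite gt_eqF.
rewrite unity_rootE; have [in_|in_] := eqVneq i.+1 n.
  apply/eqP; rewrite en in_ divff ?gt_eqF// mul1r /expi cos2pi sin2pi.
  by [].
have {}in_ : (i.+1 < n)%N by rewrite ltn_neqAle in_ ltn_ord.
rewrite en; apply/negbTE; apply/eqP => -[].
rewrite cos_mulr2n cos2sin2 => h _.
have : 0 < sin (i.+1%:R / n%:R * pi : R).
  apply: sin_gt0_pi; rewrite mulr_gt0 ?pi_gt0 ?divr_gt0 ?ltr0n//=.
  by rewrite gtr_pMl ?pi_gt0// ltr_pdivrMr// mul1r ltr_nat.
move: h; move: (sin _) => x h x0.
have : 0 < x ^+ 2 by rewrite exprn_gt0.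
lra.
Qed.

End UnitCircle.

(** * Rudin-Shapiro polynomials on the unit circle *)

Section RudinShapiro.
Variable R : realType.
Implicit Types (z w om : R[i]) (n m : nat).

Local Notation P := (rudin_shapiro_P R).
Local Notation Q := (rudin_shapiro_Q R).

Lemma rudin_shapiro_PS n z : (P n.+1).[z] = (P n).[z] + z ^+ (2 ^ n) * (Q n).[z].
Proof.
rewrite /rudin_shapiro_P /rudin_shapiro_Q /=; case: rudin_shapiro_pair => p q /=.
by rewrite hornerD hornerM hornerXn.
Qed.

Lemma rudin_shapiro_QS n z : (Q n.+1).[z] = (P n).[z] - z ^+ (2 ^ n) * (Q n).[z].
Proof.
rewrite /rudin_shapiro_P /rudin_shapiro_Q /=; case: rudin_shapiro_pair => p q /=.
by rewrite hornerD hornerN hornerM hornerXn.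
Qed.

Lemma size_rudin_shapiro n : (size (P n) <= 2 ^ n)%N && (size (Q n) <= 2 ^ n)%N.
Proof.
rewrite /rudin_shapiro_P /rudin_shapiro_Q.
elim: n => [|n]; first by rewrite /= size_poly1.
rewrite /=; case: rudin_shapiro_pair => p q /= /andP[sp sq].
have sX : (size ('X^(2 ^ n) * q)%R <= 2 ^ n.+1)%N.
  apply: leq_trans (size_polyMleq _ _) _.
  by rewrite size_polyXn addSn/= expnS mul2n -addnn leq_add2l.
have sp' : (size p <= 2 ^ n.+1)%N by rewrite (leq_trans sp)// leq_exp2l.
apply/andP; split; first by rewrite (leq_trans (size_polyD _ _))// geq_max sp'.
by rewrite (leq_trans (size_polyD _ _))// geq_max size_polyN sp'.
Qed.

Lemma rudin_shapiro_at0 n : (P n).[0] = 1 /\ (Q n).[0] = 1.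
Proof.
elim: n => [|n [IHP IHQ]]; first by rewrite /= !hornerC.
rewrite rudin_shapiro_PS rudin_shapiro_QS IHP IHQ expr0n.
by rewrite expn_eq0/= mul0r subr0 addr0.
Qed.

Lemma parallelogram z w :
  normc (z + w) ^+ 2 + normc (z - w) ^+ 2 = 2 * (normc z ^+ 2 + normc w ^+ 2).
Proof. by rewrite !normc_sqrE; case: z => a b; case: w => c d /=; ring. Qed.

Lemma rudin_shapiro_norm n z : normc z = 1 ->
  normc (P n).[z] ^+ 2 + normc (Q n).[z] ^+ 2 = 2 ^+ n.+1.
Proof.
move=> z1; elim: n => [|n IH].
  by rewrite /= !hornerC normc1; ring.
rewrite rudin_shapiro_PS rudin_shapiro_QS parallelogram [RHS]exprS -IH.
by rewrite normcM normcX z1 expr1n mul1r.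
Qed.

(** With n fixed, (blochX, blochW) in R x C is, up to the factor 2^(n+1), the
image of (P_n(z) : Q_n(z)) on the unit sphere under the Hopf map; it ignores the
common phase of P_n and Q_n. *)
Definition blochX n z : R := normc (P n).[z] ^+ 2 - normc (Q n).[z] ^+ 2.
Definition blochW n z : R[i] := 2 * ((P n).[z]^*)%C * (Q n).[z].

Lemma blochXS n z :
  blochX n.+1 z = 2 * complex.Re (z ^+ (2 ^ n) * blochW n z).
Proof.
rewrite /blochX /blochW rudin_shapiro_PS rudin_shapiro_QS mulrCA.
move: (_ * (Q n).[z]) => q; case: q => c d; case: (P n).[z] => a b.
by rewrite !normc_sqrE /=; ring.
Qed.

Lemma blochWS n z : normc z = 1 ->
  blochW n.+1 z =
    (2 * blochX n z -i* (2 * complex.Im (z ^+ (2 ^ n) * blochW n z)))%C.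
Proof.
move=> z1; rewrite /blochX /blochW rudin_shapiro_PS rudin_shapiro_QS mulrCA.
have -> : normc (Q n).[z] = normc (z ^+ (2 ^ n) * (Q n).[z]).
  by rewrite normcM normcX z1 expr1n mul1r.
move: (_ * (Q n).[z]) => q; case: q => c d; case: (P n).[z] => a b.
rewrite !normc_sqrE; apply/eqP; rewrite eq_complex /=.
by apply/andP; split; apply/eqP; ring.
Qed.

(** One step of the recursion acts on the sphere by a rotation about the axis
[blochX], of angle arg z^(2^n), followed by a fixed isometry, and a dilation
by 2. *)
Lemma bloch_step n z z' :
  let V x := x ^+ (2 ^ n) * blochW n x in
  normc z = 1 -> normc z' = 1 ->
  (blochX n.+1 z - blochX n.+1 z') ^+ 2
    + normc (blochW n.+1 z - blochW n.+1 z') ^+ 2 =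
  4 * ((blochX n z - blochX n z') ^+ 2 + normc (V z - V z') ^+ 2).
Proof.
move=> V z1 z'1; rewrite !blochXS !blochWS// -/(V z) -/(V z').
by case: (V z) => a b; case: (V z') => c d; rewrite !normc_sqrE /=; ring.
Qed.

Lemma normc_subX z z' n : normc z = 1 -> normc z' = 1 ->
  normc (z ^+ n - z' ^+ n) <= n%:R * normc (z - z').
Proof.
move=> z1 z'1; elim: n => [|n IH].
  by rewrite !expr0 subrr normc0 mul0r.
have -> : z ^+ n.+1 - z' ^+ n.+1 = z * (z ^+ n - z' ^+ n) + (z - z') * z' ^+ n.
  by rewrite !exprS; ring.
apply: le_trans (ler_normcD _ _) _.
rewrite !normcM normcX z1 z'1 expr1n mul1r mulr1.
by rewrite -natr1 mulrDl mul1r lerD2r.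
Qed.

Lemma normc_blochW n z : normc z = 1 -> normc (blochW n z) <= 2 ^+ n.+1.
Proof.
move=> z1; rewrite /blochW !normcM -(rudin_shapiro_norm n z1).
have -> : normc ((P n).[z]^*)%C = normc (P n).[z].
  by case: ((P n).[z]) => a b; rewrite /= sqrrN.
have -> : normc 2 = 2 :> R.
  by rewrite -[2]/(2%:R) -(rmorph_nat (real_complex R)) normcR ger0_norm.
move: (normc _) (normc _) => a b.
have := sqr_ge0 (a - b); nra.
Qed.

(** The rotations at z and z' differ by at most 2^k |z - z'| at step k, and
isometries preserve distances: apart from the dilations, the total is the
geometric sum (2^n - 1) |z - z'|. *)
Lemma bloch_dist n z z' : normc z = 1 -> normc z' = 1 ->
  (blochX n z - blochX n z') ^+ 2 + normc (blochW n z - blochW n z') ^+ 2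
    <= (2 ^+ n.+1 * ((2 ^+ n - 1) * normc (z - z'))) ^+ 2.
Proof.
move=> z1 z'1; set d := normc (z - z'); have d0 : 0 <= d by exact: normc_ge0.
elim: n => [|n IH].
  rewrite /blochX /blochW /= !hornerC !subrr normc0.
  by rewrite expr0n/= addr0 sqr_ge0.
rewrite (bloch_step n z1 z'1).
set D := 2 ^+ n.+1 * _ in IH.
have D0 : 0 <= D.
  by rewrite mulr_ge0 ?exprn_ge0// mulr_ge0// subr_ge0 exprn_ege1// ler1n.
have -> : 2 ^+ n.+2 * ((2 ^+ n.+1 - 1) * d) = 2 * (D + 2 ^+ n * d * 2 ^+ n.+1).
  by rewrite /D !exprS; ring.
rewrite exprMn (_ : 2 ^+ 2 = 4) ?ler_wpM2l//; last by ring.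
set u := z ^+ (2 ^ n); set u' := z' ^+ (2 ^ n).
have hV : normc (u * blochW n z - u' * blochW n z') <=
    normc (blochW n z - blochW n z') + 2 ^+ n * d * 2 ^+ n.+1.
  have -> : u * blochW n z - u' * blochW n z' =
    u * (blochW n z - blochW n z') + (u - u') * blochW n z' by ring.
  apply: le_trans (ler_normcD _ _) _.
  rewrite (normcM u) (normcM (u - u')).
  rewrite {1}/u normcX z1 expr1n mul1r lerD2l.
  rewrite ler_pM ?normc_ge0 ?normc_blochW//.
  by have := normc_subX (2 ^ n) z1 z'1; rewrite natrX.
move: hV IH; set e := 2 ^+ n * d * 2 ^+ n.+1.
have e0 : 0 <= e by rewrite mulr_ge0 ?exprn_ge0// mulr_ge0// exprn_ge0.
have := normc_ge0 (u * blochW n z - u' * blochW n z').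
have := normc_ge0 (blochW n z - blochW n z').
move: (normc (blochW n z - _)) (normc (u * _ - _)) (blochX n z - _) => x y X.
move=> x0 y0 hy hD.
have xD : x <= D by rewrite -(@ler_pXn2r _ 2)// ?nnegrE//; nra.
nra.
Qed.

End RudinShapiro.

(** * Lower bound for the Mahler measure *)

Section MahlerLowerBound.
Variable R : realType.
Implicit Types (z w om : R[i]) (n m : nat).

Local Notation P := (rudin_shapiro_P R).
Local Notation Q := (rudin_shapiro_Q R).

Definition normalized_Q n : {poly R[i]} :=
  (2 `^ (- (n.+1%:R / 2)))%:C%C *: Q n.

Lemma normalization_sq n : (2 `^ (- (n.+1%:R / 2)) : R) ^+ 2 * 2 ^+ n.+1 = 1.
Proof.
rewrite -powR_mulrn ?powR_ge0// -powRrM mulNr divfK// powRN powR_mulrn//.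
by rewrite mulVf// expf_neq0.
Qed.

Lemma normc_scale_horner (x : R) (p : {poly R[i]}) z :
  normc (x%:C%C *: p).[z] ^+ 2 = x ^+ 2 * normc p.[z] ^+ 2.
Proof.
rewrite hornerZ normcM normcR exprMn.
by rewrite real_normK ?num_real.
Qed.

Lemma normalized_norm n z : normc z = 1 ->
  normc (normalized_P R n).[z] ^+ 2 + normc (normalized_Q n).[z] ^+ 2 = 1.
Proof.
move=> z1; rewrite !normc_scale_horner -mulrDr rudin_shapiro_norm//.
exact: normalization_sq.
Qed.

Lemma normalized_Q_neq0 n : normalized_Q n != 0.
Proof.
apply/eqP => /(congr1 (fun p => p.[0])).
rewrite hornerZ (rudin_shapiro_at0 R n).2 mulr1 horner0 => -[/eqP].
by rewrite powR_eq0 => /andP[/eqP]; lra.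
Qed.

Lemma size_normalized_Q n : (size (normalized_Q n) <= 2 ^ n)%N.
Proof.
apply: leq_trans (size_scale_leq _ _) _.
by have /andP[] := size_rudin_shapiro R n.
Qed.

Lemma rudin_shapiro_Q_even m z : z ^+ (2 ^ m.+1) = 1 -> normc z = 1 ->
  normc (Q m.+2).[z] ^+ 2 = 2 * (2 ^+ m.+1 - blochX m z).
Proof.
move=> z2 z1; rewrite rudin_shapiro_QS z2 rudin_shapiro_PS rudin_shapiro_QS.
rewrite -(rudin_shapiro_norm m z1) /blochX.
have -> : (P m).[z] + z ^+ (2 ^ m) * (Q m).[z]
    - 1 * ((P m).[z] - z ^+ (2 ^ m) * (Q m).[z])
  = z ^+ (2 ^ m) * ((Q m).[z] + (Q m).[z]) by ring.
rewrite normcM normcX z1 expr1n mul1r -mulr2n normcMn.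
by ring.
Qed.

Lemma rudin_shapiro_Q_odd m z : z ^+ (2 ^ m.+1) = -1 -> normc z = 1 ->
  normc (Q m.+2).[z] ^+ 2 = 2 * (2 ^+ m.+1 + blochX m z).
Proof.
move=> z2 z1; rewrite rudin_shapiro_QS z2 rudin_shapiro_PS rudin_shapiro_QS.
rewrite -(rudin_shapiro_norm m z1) /blochX.
have -> : (P m).[z] + z ^+ (2 ^ m) * (Q m).[z]
    - -1 * ((P m).[z] - z ^+ (2 ^ m) * (Q m).[z])
  = (P m).[z] + (P m).[z] by ring.
by rewrite -mulr2n normcMn; ring.
Qed.

Lemma blochX_dist m z z' : normc z = 1 -> normc z' = 1 ->
  `|blochX m z - blochX m z'| <= 2 ^+ m.+1 * (2 ^+ m * normc (z - z')).
Proof.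
move=> z1 z'1; have := bloch_dist m z1 z'1.
set D := 2 ^+ m.+1 * ((2 ^+ m - 1) * _) => hD.
have m1 : 1 <= 2 ^+ m :> R by rewrite exprn_ege1// ler1n.
have d0 : 0 <= normc (z - z') by exact: normc_ge0.
have S0 : 0 <= 2 ^+ m.+1 :> R by rewrite exprn_ge0.
have D0 : 0 <= D by rewrite mulr_ge0// mulr_ge0// subr_ge0.
apply: (@le_trans _ _ D); last by rewrite ler_wpM2l// ler_wpM2r// gerBl.
rewrite -(@ler_pXn2r _ 2)// ?nnegrE// real_normK ?num_real//.
by apply: le_trans hD; rewrite lerDl sqr_ge0.
Qed.

(** By [rudin_shapiro_Q_even] and [rudin_shapiro_Q_odd], |Q_(m+2)|^2 small at
both z and z om would force blochX m to be near the opposite ends of its range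
at z and at z om, against [blochX_dist]. *)
Lemma adjacent_roots m om z : (2 ^ m.+2).-primitive_root om ->
  z ^+ (2 ^ m.+2) = 1 ->
  1 - 2 ^+ m * normc (1 - om) / 2 <=
    normc (normalized_Q m.+2).[z] ^+ 2 + normc (normalized_Q m.+2).[z * om] ^+ 2.
Proof.
move=> prim_om zN; have om1 := normc_prim_root prim_om.
have N0 : (0 < 2 ^ m.+2)%N by rewrite expn_gt0.
have z1 : normc z = 1 by exact: normc_unity_root zN.
have zo1 : normc (z * om) = 1 by rewrite normcM z1 om1 mulr1.
have dist : normc (z - z * om) = normc (1 - om).
  by rewrite -[X in X - _]mulr1 -mulrBr normcM z1 mul1r.
have half (x : R[i]) : x ^+ (2 ^ m.+2) = 1 ->
    x ^+ (2 ^ m.+1) = 1 \/ x ^+ (2 ^ m.+1) = -1.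
  rewrite (expnSr 2 m.+1) exprM => /eqP; rewrite sqrf_eq1.
  by case/orP => /eqP; [left|right].
have om2 : om ^+ (2 ^ m.+1) = -1.
  have [h|//] := half _ (prim_expr_order prim_om).
  have : (2 ^ m.+2 %| 2 ^ m.+1)%N by rewrite (prim_order_dvd prim_om) h.
  by move=> /dvdn_leq; rewrite expn_gt0 => /(_ erefl); rewrite leq_exp2l// ltnn.
have := blochX_dist m z1 zo1; rewrite dist.
set x := 2 ^+ m * _; set X := blochX m z; set X' := blochX m (z * om).
rewrite ler_norml => /andP[h1 h2].
have hS := normalization_sq m.+2; rewrite !normc_scale_horner -mulrDr.
set l := (2 `^ _) ^+ 2 in hS *; have l0 : 0 <= l by exact: sqr_ge0.
have lS : l * 2 ^+ m.+1 = 4^-1.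
  by move: hS; rewrite !exprS => hS; apply: (@mulIf _ 4) => //; lra.
suff : 2 * (2 * 2 ^+ m.+1 - 2 ^+ m.+1 * x) <=
    normc (Q m.+2).[z] ^+ 2 + normc (Q m.+2).[z * om] ^+ 2.
  move=> /(ler_wpM2l l0); apply: le_trans.
  have -> : l * (2 * (2 * 2 ^+ m.+1 - 2 ^+ m.+1 * x)) =
     (l * 2 ^+ m.+1) * (4 - 2 * x) by ring.
  by rewrite lS; lra.
have [z2|z2] := half z zN.
- rewrite (rudin_shapiro_Q_even z2 z1) rudin_shapiro_Q_odd//.
    by rewrite -/X -/X'; lra.
  by rewrite exprMn z2 om2 mul1r.
- rewrite (rudin_shapiro_Q_odd z2 z1) rudin_shapiro_Q_even//.
    by rewrite -/X -/X'; lra.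
  by rewrite exprMn z2 om2 mulrNN mulr1.
Qed.

(** Here |1 - om| <= 2 pi / 2^(m+2), so the left side in [adjacent_roots] is at
least 1 - pi/4, which is positive because pi < 4. *)
Lemma mahler_normalized_QSS : exists2 c : R, 0 < c &
  forall m, c <= mahler (normalized_Q m.+2).
Proof.
(* Of two numbers with sum at least 1 - pi/4, one is at least half of it. *)
pose c := Num.sqrt ((1 - pi / 4) / 2 : R).
have c2 : 0 < (1 - pi / 4) / 2 :> R by have := @pihalf_lt2 R; lra.
have c0 : 0 < c by rewrite sqrtr_gt0.
exists (c / (2 * expR (2 * pi))); first by rewrite divr_gt0// mulr_gt0// expR_gt0.
move=> m; rewrite ler_pdivrMr ?mulr_gt0 ?expR_gt0//.
set N := (2 ^ m.+2)%N; have N0 : (0 < N)%N by rewrite expn_gt0.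
have prim_om := @prim_root_expi R N N0; set om := expi _ in prim_om.
have NR : N%:R = 4 * 2 ^+ m :> R by rewrite /N natrX !exprS; ring.
have m0 : 0 < 2 ^+ m :> R by rewrite exprn_gt0.
set d := normc (1 - om); have d0 : 0 <= d by exact: normc_ge0.
have dN : d <= 2 * pi / N%:R.
  apply: le_trans (normc_1Bexpi _) _.
  by rewrite ger0_norm// divr_ge0// mulr_ge0// pi_ge0.
have dm : 2 ^+ m * d / 2 <= pi / 4.
  move: dN; rewrite NR => dN; have := ler_wpM2l (ltW m0) dN.
  have -> : 2 ^+ m * (2 * pi / (4 * 2 ^+ m)) = pi / 2 :> R.
    by field; rewrite gt_eqF.
  lra.
pose f z := normc (normalized_Q m.+2).[z].
have adj z : z ^+ N = 1 -> ~~ (c <= f z) -> c <= f (z * om).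
  move=> zN; rewrite -ltNge => fz.
  have := adjacent_roots prim_om zN; rewrite -/d -/(f z) -/(f (z * om)) => h.
  rewrite -(@ler_pXn2r _ 2) ?nnegrE ?(ltW c0) ?normc_ge0//.
  have : f z ^+ 2 < c ^+ 2 by rewrite ltr_pXn2r// nnegrE ?normc_ge0// ltW.
  by rewrite (sqr_sqrtr (ltW c2)); lra.
have adj' z : z ^+ N = 1 -> ~~ (c <= f z) -> c <= f (z / om).
  move=> zN fz; apply: contraT => fzo.
  have : c <= f (z / om * om).
    apply: adj fzo; rewrite exprMn zN exprVn mul1r.
    by rewrite (prim_expr_order prim_om) invr1.
  rewrite divfK ?(negbTE fz)//; apply/eqP => om0.
  have := prim_expr_order prim_om; rewrite om0 expr0n gtn_eqF// => /eqP.
  by rewrite eq_sym oner_eq0.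
have := @mahler_ge R N om (normalized_Q m.+2) (fun k => c <= f (om ^+ k)) c
  prim_om (normalized_Q_neq0 _) (leqW (size_normalized_Q _)) (ltW c0).
rewrite -/d => h.
apply: le_trans (h _) _.
  move=> k _; case: ifPn => // fk.
  have kN : (om ^+ k) ^+ N = 1 by rewrite exprAC (prim_expr_order prim_om) expr1n.
  by rewrite -/(f _) -/(f (om ^+ k * om)) adj// adj'.
rewrite ler_wpM2l ?(ltW (mahler_gt0 (normalized_Q_neq0 _)))// ler_wpM2l//.
apply: le_trans (_ : expR d ^+ N <= _).
  by rewrite lerXn2r ?nnegrE ?addr_ge0 ?expR_ge0 ?expR_ge1Dx.
rewrite -expRM_natl ler_expR.
by move: dN; rewrite ler_pdivlMr ?ltr0n// mulrC.
Qed.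

Lemma mahler_normalized_Q : exists2 c : R, 0 < c &
  forall n, c <= mahler (normalized_Q n).
Proof.
have [c c0 h] := mahler_normalized_QSS.
pose c1 := Num.min (mahler (normalized_Q 0)) (mahler (normalized_Q 1)).
exists (Num.min c1 c).
  by rewrite !lt_min c0 !mahler_gt0// normalized_Q_neq0.
case=> [|[|m]]; rewrite !ge_min ?lexx ?orbT//.
by rewrite h orbT.
Qed.

End MahlerLowerBound.

(** * Riemann sums *)

Section RiemannSums.
Variable R : realType.
Implicit Types (h : R -> R) (b C D : R).
Local Notation mu := (@lebesgue_measure R).

Lemma lipschitz_const_ge0 h D :
  (forall s t, `|h s - h t| <= D * `|s - t|) -> 0 <= D.
Proof.
by move=> hD; have := le_trans (normr_ge0 _) (hD 1 0); rewrite subr0 normr1 mulr1.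
Qed.

Lemma lipschitz_continuous h D :
  (forall s t, `|h s - h t| <= D * `|s - t|) -> continuous h.
Proof.
move=> hD x; apply/cvgrPdist_lt => e e0.
have D0 := lipschitz_const_ge0 hD.
have d0 : 0 < e / (D + 1) by rewrite divr_gt0// ltr_wpDl.
near=> y; apply: le_lt_trans (hD _ _) _.
have : `|x - y| < e / (D + 1).
  by near: y; apply: (@cvgr_dist_lt _ _ _ (nbhs x) _ id).
rewrite ltr_pdivlMr ?ltr_wpDl// => hy.
by apply: le_lt_trans hy; rewrite mulrC ler_wpM2l// lerDl.
Unshelve. all: by end_near. Qed.

Lemma integral_cells_le h D (l : R) : (forall t, 0 <= h t) ->
  (forall s t, `|h s - h t| <= D * `|s - t|) -> 0 <= l ->
  forall n, (\int[mu]_(t in `[0%R, (n%:R * l)%R[) (h t)%:E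
     <= (\sum_(0 <= j < n) l * (h (j%:R * l) + D * l))%:E)%E.
Proof.
move=> h0 hD l0.
have mh (A : set R) : measurable A -> measurable_fun A h.
  move=> mA; apply: measurable_funTS.
  by apply: continuous_measurable_fun; exact: lipschitz_continuous hD.
have D0 := lipschitz_const_ge0 hD.
elim=> [|n IH].
  by rewrite mul0r set_itvco0 integral_set0 big_geq.
have nl : n%:R * l <= n.+1%:R * l by rewrite ler_wpM2r// ler_nat.
have n0 : 0 <= n%:R * l by rewrite mulr_ge0.
have -> : `[0%R, (n.+1%:R * l)%R[%classic =
    (`[0%R, (n%:R * l)%R[ `|` `[(n%:R * l)%R, (n.+1%:R * l)%R[)%classic :> set R.
  apply: itv_bndbnd_setU.
    by rewrite bnd_simp.
  by rewrite bnd_simp.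
rewrite ge0_integral_setU//=; first last.
- apply/disj_set2P; rewrite -subset0 => x /=.
  by rewrite !in_itv/= => -[/andP[_ h1] /andP[h2 _]]; move: h1; rewrite ltNge h2.
- by move=> x _; rewrite lee_fin.
- by apply/measurable_EFinP; apply: mh; exact: measurableU.
rewrite big_nat_recr//= EFinD leeD//.
apply: le_trans (_ : \int[mu]_(t in `[(n%:R * l)%R, (n.+1%:R * l)%R[)
   (cst (h (n%:R * l) + D * l)%:E t) <= _)%E.
  apply: ge0_le_integral => //=.
  - by move=> x _; rewrite lee_fin.
  - by apply/measurable_EFinP; exact: mh.
  - move=> x; rewrite in_itv/= => /andP[x1 x2]; rewrite lee_fin.
    have := hD x (n%:R * l); rewrite ler_norml => /andP[_].
    rewrite lerBlDl => /le_trans; apply; rewrite lerD2l ler_wpM2l//.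
    rewrite ger0_norm ?subr_ge0// lerBlDl.
    by move: x2; rewrite -natr1 mulrDl mul1r => /ltW.
rewrite integral_cst//= lebesgue_measure_itv/= lte_fin.
case: ifPn => [_|].
  rewrite -EFinB -EFinM lee_fin.
  have -> : n.+1%:R * l - n%:R * l = l by rewrite -natr1; ring.
  by rewrite mulrC.
rewrite mule0 lee_fin => _; rewrite mulr_ge0// addr_ge0//.
by rewrite mulr_ge0.
Qed.

(** A bound valid for all fine enough Riemann sums passes to the integral: on
each cell of length b/n the Lipschitz function exceeds its left value by at
most D b/n, which costs D b^2/n in total. *)
Lemma integral_riemann_le h D b C : (forall t, 0 <= h t) ->
  (forall s t, `|h s - h t| <= D * `|s - t|) -> 0 < b ->
  (exists n0, forall n, (n0 <= n)%N ->
     \sum_(0 <= j < n) h (j%:R * (b / n%:R)) <= n%:R * C) ->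
  (\int[mu]_(t in `[0%R, b]) (h t)%:E <= (b * C)%:E)%E.
Proof.
move=> h0 hD b0 [n0 hn0].
have D0 := lipschitz_const_ge0 hD.
rewrite -integral_itv_bndo_bndc; last first.
  apply/measurable_EFinP; apply: measurable_funTS.
  by apply: continuous_measurable_fun; exact: lipschitz_continuous hD.
apply/lee_addgt0Pr => e e0.
pose n := maxn n0 (Num.bound (D * b ^+ 2 / e)).+1.
have nn0 : (n0 <= n)%N by rewrite leq_maxl.
have n_gt0 : 0 < n%:R :> R by rewrite ltr0n (leq_trans _ (leq_maxr _ _)).
have ne : D * b ^+ 2 / n%:R <= e.
  have q0 : 0 <= D * b ^+ 2 / e by rewrite divr_ge0 ?(ltW e0)// mulr_ge0// sqr_ge0.
  rewrite ler_pdivrMr// [leRHS]mulrC -ler_pdivrMr//.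
  apply: ltW; apply: lt_le_trans (archi_boundP q0) _.
  by rewrite ler_nat (leq_trans (leqnSn _) (leq_maxr _ _)).
have l0 : 0 <= b / n%:R by rewrite divr_ge0// ltW.
have := integral_cells_le h0 hD l0 n.
have -> : n%:R * (b / n%:R) = b by field; rewrite gt_eqF.
move=> /le_trans; apply.
rewrite -EFinD lee_fin -big_distrr/= big_split/= sumr_const_nat subn0.
have := hn0 n nn0; set S := \sum_(0 <= j < n) _ => hS.
have -> : b / n%:R * (S + D * (b / n%:R) *+ n) =
    b / n%:R * S + D * b ^+ 2 / n%:R.
  by rewrite -[_ *+ n]mulr_natr; field; rewrite gt_eqF.
rewrite lerD//; have := ler_wpM2l l0 hS.
by have -> : b / n%:R * (n%:R * C) = b * C by field; rewrite gt_eqF.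
Qed.

End RiemannSums.

(** * Truncated logarithmic series *)

Section LogSeries.
Variable R : realType.
Implicit Types (x y : R) (n K : nat).

(** The Taylor polynomial of -ln (1 - x) at 0. *)
Definition log_partial K x : R := \sum_(1 <= k < K.+1) x ^+ k / k%:R.

Definition geom_sum K x : R := \sum_(0 <= i < K) x ^+ i.

Lemma geom_sum_ge1 K x : 0 <= x -> 1 <= geom_sum K.+1 x.
Proof.
move=> x0; rewrite /geom_sum big_nat_recl// expr0 lerDl.
by rewrite sumr_ge0// => i _; rewrite exprn_ge0.
Qed.

Lemma geom_sum_le K x : 0 <= x <= 1 -> geom_sum K x <= K%:R.
Proof.
move=> /andP[x0 x1]; apply: le_trans (_ : \sum_(0 <= i < K) 1 <= _).
  by apply: ler_sum => i _; rewrite exprn_ile1.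
by rewrite sumr_const_nat subn0.
Qed.

(** Write s_k for the sum of the x^i with i < k.  As s_k <= k, the term x^k / k
is at most (s_(k+1) - s_k) / s_k, hence at most twice ln s_(k+1) - ln s_k, and
these differences telescope.  The factor 2 compares s_k with s_(k+1). *)
Lemma log_partial_le_ln K x : 0 <= x <= 1 ->
  log_partial K x <= 2 * ln (geom_sum K.+1 x).
Proof.
move=> /andP[x0 x1]; elim: K => [|K IH].
  by rewrite /log_partial /geom_sum big_geq// big_nat1 expr0 ln1 mulr0.
rewrite /log_partial big_nat_recr//= -/(log_partial K x).
have s1 := geom_sum_ge1 K x0.
have sK : geom_sum K.+1 x <= K.+1%:R by rewrite geom_sum_le// x0.
have -> : geom_sum K.+2 x = geom_sum K.+1 x + x ^+ K.+1.
  by rewrite /geom_sum big_nat_recr.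
have e0 : 0 <= x ^+ K.+1 by rewrite exprn_ge0.
have e1 : x ^+ K.+1 <= 1 by rewrite exprn_ile1.
move: (geom_sum _ _) (x ^+ K.+1) IH s1 sK e0 e1 => s e IH s1 sK e0 e1.
have s0 : 0 < s by lra.
have se0 : 0 < s + e by lra.
have hln : ln s - ln (s + e) <= - (e / (s + e)).
  rewrite -ln_div ?posrE//.
  have -> : s / (s + e) = 1 + - (e / (s + e)) by field; rewrite gt_eqF.
  by apply: le_ln1Dx; rewrite ltrN2 ltr_pdivrMr// mul1r; lra.
suff : e / K.+1%:R <= 2 * (e / (s + e)).
  by move: (e / K.+1%:R) (e / (s + e)) hln => u v; lra.
rewrite mulrCA ler_wpM2l//.
rewrite ler_pdivlMr// mulrC ler_pdivrMr ?ltr0n//; lra.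
Qed.

(** The geometric sum is at most both 1/(1 - x) and K + 1, and
y^2 = 1 - x^2 <= 2 (1 - x). *)
Lemma log_partial_le K x y : 0 <= x -> x ^+ 2 + y ^+ 2 = 1 ->
  log_partial K x <= 2 * ln (4 / (y ^+ 2 + 2 / K.+1%:R)).
Proof.
move=> x0 xy.
have x1 : x <= 1.
  by rewrite -(@ler_pXn2r _ 2) ?nnegrE// expr1n -xy lerDl sqr_ge0.
apply: le_trans (log_partial_le_ln K _) _; first by rewrite x0.
have s1 := geom_sum_ge1 K x0.
have K0 : 0 < K.+1%:R :> R by rewrite ltr0n.
have e0 : 0 < 2 / K.+1%:R :> R by rewrite divr_gt0.
have ye0 : 0 < y ^+ 2 + 2 / K.+1%:R by rewrite ltr_wpDl// sqr_ge0.
rewrite ler_wpM2l// ler_ln ?posrE ?divr_gt0//; last by lra.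
rewrite ler_pdivlMr//.
have tel : geom_sum K.+1 x * (1 - x) <= 1.
  have -> : geom_sum K.+1 x * (1 - x) = 1 - x ^+ K.+1.
    rewrite -[in RHS](expr1n _ K.+1) subrXX mulrC /geom_sum big_mkord.
    by congr (_ * _); apply: eq_bigr => i _; rewrite expr1n mul1r.
  by rewrite gerBl exprn_ge0.
have sK : geom_sum K.+1 x * (2 / K.+1%:R) <= 2.
  by rewrite mulrA ler_pdivrMr// [leRHS]mulrC ler_wpM2r// geom_sum_le// x0.
rewrite mulrDr.
have : geom_sum K.+1 x * y ^+ 2 <= 2 * (geom_sum K.+1 x * (1 - x)).
  have -> : 2 * (geom_sum K.+1 x * (1 - x)) = geom_sum K.+1 x * (2 * (1 - x)) by ring.
  by apply: ler_wpM2l; [lra|nra].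
by move: (_ * (2 / _)) (_ * y ^+ 2) (_ * (1 - x)) tel sK => u v w; lra.
Qed.

Lemma log_partial_ge0 K x : 0 <= x -> 0 <= log_partial K x.
Proof.
by move=> x0; apply: sumr_ge0 => k _; rewrite divr_ge0// exprn_ge0.
Qed.

Lemma normr_subX n x y : 0 <= x <= 1 -> 0 <= y <= 1 ->
  `|x ^+ n - y ^+ n| <= n%:R * `|x - y|.
Proof.
move=> /andP[x0 x1] /andP[y0 y1]; rewrite subrXX normrM mulrC ler_wpM2r//.
apply: le_trans (ler_norm_sum _ _ _) _.
apply: le_trans (_ : \sum_(i < n) 1 <= _); last by rewrite sumr_const card_ord.
apply: ler_sum => i _; rewrite ger0_norm ?mulr_ge0 ?exprn_ge0//.
by rewrite mulr_ile1 ?exprn_ge0 ?exprn_ile1.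
Qed.

Lemma log_partial_lipschitz K x y : 0 <= x <= 1 -> 0 <= y <= 1 ->
  `|log_partial K x - log_partial K y| <= K%:R * `|x - y|.
Proof.
move=> hx hy; rewrite /log_partial -sumrB.
apply: le_trans (ler_norm_sum _ _ _) _.
apply: le_trans (_ : \sum_(1 <= k < K.+1) `|x - y| <= _); last first.
  by rewrite sumr_const_nat subn1 mulr_natl.
rewrite big_seq [leRHS]big_seq; apply: ler_sum => k.
rewrite mem_index_iota => /andP[k0 _].
rewrite -mulrBl normrM normfV normr_nat ler_pdivrMr ?ltr0n// mulrC.
exact: normr_subX.
Qed.

Lemma sum_ln (f : nat -> R) n : (forall k, 0 < f k) ->
  \sum_(0 <= k < n) ln (f k) = ln (\prod_(0 <= k < n) f k).
Proof.
move=> f0; elim: n => [|n IH]; first by rewrite !big_geq// ln1.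
by rewrite !big_nat_recr//= lnM ?posrE ?IH//; apply: prodr_gt0 => k _.
Qed.

End LogSeries.

(** * Summation over the exponents *)

Section ExponentSum.
Variable R : realType.
Implicit Types (n m K : nat) (s t : R).

Lemma normc_horner_expi_lipschitz (p : {poly R[i]}) : exists2 D : R, 0 <= D &
  forall s t, `|normc p.[expi s] - normc p.[expi t]| <= D * `|s - t|.
Proof.
exists (\sum_(i < size p) normc p`_i * i%:R).
  by rewrite sumr_ge0// => i _; rewrite mulr_ge0 ?normc_ge0.
move=> s t.
have h : normc (expi s - expi t) <= `|s - t|.
  have -> : expi s - expi t = - (expi t * (1 - expi (s - t))).
    by rewrite mulrBr mulr1 -expiD [t + _]addrC subrK opprB.
  rewrite normc_opp normcM normc_expi mul1r.
  exact: normc_1Bexpi.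
apply: (@le_trans _ _ (normc (p.[expi s] - p.[expi t]))).
  rewrite ler_norml ler_normcB andbT lerNl opprB normc_distC.
  exact: ler_normcB.
rewrite !horner_coef -sumrB mulr_suml.
apply: le_trans (normc_sum _ _) _; apply: ler_sum => i _.
rewrite -mulrBr normcM -mulrA ler_wpM2l ?normc_ge0//.
apply: le_trans (normc_subX _ (normc_expi _) (normc_expi _)) _.
by rewrite ler_wpM2l.
Qed.

Definition abs_P n t : R := normc (normalized_P R n).[expi t].

Lemma abs_P_itv n t : 0 <= abs_P n t <= 1.
Proof.
rewrite normc_ge0/=.
rewrite -(@ler_pXn2r _ 2) ?nnegrE ?normc_ge0// expr1n.
by rewrite -(normalized_norm n (normc_expi t)) lerDl sqr_ge0.
Qed.

(** [log_partial_le] turns the Riemann sum into the logarithm of the product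
bounded in [regularized_prod_ge], with e = 2/(K+1).  The threshold m0 depends on
n and K, but the bound does not. *)
Lemma riemann_sum_log_partial n K (c : R) :
  0 < c -> c <= mahler (normalized_Q R n) ->
  exists m0, forall m, (m0 <= m)%N ->
    \sum_(0 <= j < m) log_partial K (abs_P n (j%:R * (2 * pi / m%:R)))
      <= m%:R * (2 * ln (16 / c ^+ 2)).
Proof.
move=> c0 hc; have e0 : 0 < 2 / K.+1%:R :> R by rewrite divr_gt0// ltr0n.
have [m0 hm0] := regularized_prod_ge (normalized_Q_neq0 R n) e0.
exists (maxn m0 1) => m; rewrite geq_max => /andP[m0m m1].
have := hm0 m _ m0m (prim_root_expi R m1).
set om := expi _ => hprod.
pose f k := 4 / (normc (normalized_Q R n).[om ^+ k] ^+ 2 + 2 / K.+1%:R).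
have f0 k : 0 < f k by rewrite divr_gt0// ltr_wpDl// sqr_ge0.
apply: le_trans (_ : _ <= \sum_(0 <= j < m) 2 * ln (f j)) _.
  apply: ler_sum => j _; apply: log_partial_le.
    by case/andP: (abs_P_itv n (j%:R * (2 * pi / m%:R))).
  rewrite /abs_P mulr_natl expiMn normalized_norm//.
  by rewrite normcX normc_expi expr1n.
rewrite -big_distrr/= sum_ln// mulrCA ler_wpM2l//.
rewrite (mulr_natl _ m) -lnXn ?divr_gt0 ?exprn_gt0//.
rewrite ler_ln ?posrE ?exprn_gt0 ?divr_gt0 ?exprn_gt0//; last first.
  by apply: prodr_gt0 => k _.
rewrite /f big_split/= prodr_const_nat subn0 prodfV.
have -> : 16 / c ^+ 2 = 4 * (4 / c ^+ 2) by ring.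
rewrite exprMn ler_wpM2l ?exprn_ge0//.
have cm : (c / 2) ^+ (2 * m) <= (mahler (normalized_Q R n) / 2) ^+ (2 * m).
  by rewrite lerXn2r ?nnegrE ?divr_ge0 ?(ltW c0) ?(le_trans (ltW c0) hc)// ler_wpM2r.
have -> : (4 / c ^+ 2) ^+ m = ((c / 2) ^+ (2 * m))^-1.
  have e : (c / 2) ^+ 2 = (4 / c ^+ 2)^-1 by field; rewrite gt_eqF.
  by rewrite exprM e exprVn invrK.
rewrite lef_pV2 ?posrE ?exprn_gt0 ?divr_gt0//; first exact: le_trans cm hprod.
by apply: prodr_gt0 => k _; rewrite ltr_wpDl// sqr_ge0.
Qed.

Lemma integral_log_partial n K (c : R) :
  0 < c -> c <= mahler (normalized_Q R n) ->
  (\int[lebesgue_measure]_(t in `[0%R, (2 * pi)%R]) (log_partial K (abs_P n t))%:E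
     <= (2 * pi * (2 * ln (16 / c ^+ 2)))%:E)%E.
Proof.
move=> c0 hc; have [D D0 hD] := normc_horner_expi_lipschitz (normalized_P R n).
apply: (@integral_riemann_le _ _ (K%:R * D)).
- by move=> t; rewrite log_partial_ge0//; case/andP: (abs_P_itv n t).
- move=> s t.
  apply: le_trans (log_partial_lipschitz K (abs_P_itv n s) (abs_P_itv n t)) _.
  by rewrite -mulrA ler_wpM2l// hD.
- by rewrite mulr_gt0 ?pi_gt0.
- exact: riemann_sum_log_partial.
Qed.

Lemma Iq_abs_P n k : Iq (k%:R) (normalized_P R n) =
  (((2 * pi)^-1)%:E *
   \int[lebesgue_measure]_(t in `[0%R, (2 * pi)%R]) (abs_P n t ^+ k)%:E)%E.
Proof.
rewrite /Iq; congr (_ * _)%E; apply: eq_integral => t _.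
by rewrite powR_mulrn// normc_ge0.
Qed.

Lemma measurable_abs_PX n k (A : set R) :
  measurable A -> measurable_fun A (fun t => abs_P n t ^+ k).
Proof.
move=> mA; apply: measurable_funTS.
have [D D0 hD] := normc_horner_expi_lipschitz (normalized_P R n).
apply: continuous_measurable_fun; apply: (@lipschitz_continuous _ _ (k%:R * D)).
move=> s t; apply: le_trans (normr_subX k (abs_P_itv n s) (abs_P_itv n t)) _.
by rewrite -mulrA ler_wpM2l// hD.
Qed.

Lemma sum_Iq n K :
  (\sum_(1 <= k < K.+1) ((k%:R)^-1)%:E * Iq (k%:R) (normalized_P R n) =
   ((2 * pi)^-1)%:E *
   \int[lebesgue_measure]_(t in `[0%R, (2 * pi)%R]) (log_partial K (abs_P n t))%:E)%E.
Proof.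
have m0 t k : 0 <= abs_P n t ^+ k.
  by rewrite exprn_ge0//; case/andP: (abs_P_itv n t).
under [X in _ = (_ * X)%E]eq_integral => t _.
  rewrite /log_partial -sumEFin.
  under eq_bigr do rewrite mulrC EFinM.
  over.
rewrite ge0_integral_sum//=; first last.
- by move=> k t _; rewrite mule_ge0// lee_fin.
- move=> k; apply/measurable_EFinP; apply: measurable_funM.
    exact: measurable_cst.
  exact: measurable_abs_PX.
rewrite ge0_sume_distrr; last first.
  by move=> k _; apply: integral_ge0 => t _; rewrite mule_ge0// lee_fin.
apply: eq_bigr => k _; rewrite Iq_abs_P ge0_integralZl_EFin//=.
- exact: muleCA.
- by move=> t _; rewrite lee_fin.
- by apply/measurable_EFinP; exact: measurable_abs_PX.
Qed.

End ExponentSum.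

Theorem theorem2p2 (R : realType) :
  exists L : R, forall n : nat,
    (\sum_(1 <= k <oo) ((k%:R)^-1)%:E * Iq (k%:R) (normalized_P R n) < L%:E)%E.
Proof.
have [c c0 hc] := mahler_normalized_Q R.
exists (2 * ln (16 / c ^+ 2) + 1) => n.
apply: (@le_lt_trans _ _ (2 * ln (16 / c ^+ 2))%:E); last by rewrite lte_fin ltrDl.
have Iq_ge0 k : (0 <= ((k%:R)^-1)%:E * Iq (k%:R) (normalized_P R n))%E.
  rewrite mule_ge0 ?lee_fin ?invr_ge0// mule_ge0//.
    by rewrite lee_fin invr_ge0 mulr_ge0// pi_ge0.
  by apply: integral_ge0 => t _; rewrite lee_fin powR_ge0.
apply: lime_le; first by apply: is_cvg_nneseries => k _ _; exact: Iq_ge0.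
near=> K; have K0 : (0 < K)%N by near: K; exact: nbhs_infty_gt.
rewrite -(prednK K0) sum_Iq.
have p0 : 0 < 2 * pi :> R by rewrite mulr_gt0 ?pi_gt0.
have := integral_log_partial K.-1 c0 (hc n).
move=> /(lee_wpmul2l (_ : 0 <= ((2 * pi)^-1)%:E)%E) => /(_ _)/le_trans; apply.
  by rewrite lee_fin invr_ge0 ltW.
by rewrite -EFinM mulKf ?gt_eqF.
Unshelve. all: by end_near. Qed.
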